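(* Suppose $\alpha<\beta<|a|_p$. Then the $p$-adic dynamical system generated by $f$ has the following properties. 1. (1.1) $SI(x_1)=U_{\alpha\beta/|a|_p}(0)$. (1.2) $x_2\in S_{|a|_p}(0)$. 2. If $x\in S_{\alpha\beta/|a|_p}(0)$, then one of the following two possibilities holds: (2.1) there exist $k\in\mathbb N$ and $\mu_k<\alpha\beta/|a|_p$ such that $f^m(x)\in S_{\mu_k}(0)$ for all $m\ge k$ and $f^m(x)\in S_{\alpha\beta/|a|_p}(0)$ for $m\le k-1$; (2.2) the trajectory $\{f^k(x):k\ge1\}$ is a subset of $S_{\alpha\beta/|a|_p}(0)$. 3. The fixed point $x_2$ is attractive and $A(x_2)=\mathbb C_p\setminus\big(V_{\alpha\beta/|a|_p}(0)\cup\mathcal P\big)$.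
   Context: $p$ is a prime and $\mathbb C_p$ is the field of complex $p$-adic numbers with norm $|\cdot|_p$. Let $a,b,d\in\mathbb C_p$ with $ab\neq0$, $a\ne d$, and $$f(x)=\frac{ax^2+bx}{x^2+dx+b},\qquad x\in\mathbb C_p\setminus\{\hat x_1,\hat x_2\},$$ where $\hat x_1,\hat x_2\in\mathbb C_p$ are the two (possibly equal) roots of $x^2+dx+b$. Put $\alpha=|\hat x_1|_p$, $\beta=|\hat x_2|_p$, labelled so that $\alpha\le\beta$. Standing assumption: $f$ has the two distinct fixed points $x_1=0$ and $x_2=a-d$ (in particular $x_2\notin\{\hat x_1,\hat x_2\}$, i.e. $b+a(a-d)\neq0$). $\mathcal P=\{x\in\mathbb C_p:\exists n\in\mathbb N\cup\{0\},\ f^n(x)\in\{\hat x_1,\hat x_2\}\}$, where $f^n$ is the $n$-th iterate ($f^0=\mathrm{id}$). For $c\in\mathbb C_p$, $r\geq 0$: $U_r(c)=\{x:|x-c|_p<r\}$, $V_r(c)=\{x:|x-c|_p\le r\}$, $S_r(c)=\{x:|x-c|_p=r\}$ (so $S_0(0)=\{0\}$; $\mu_k$ denotes a nonnegative real, possibly $0$). A fixed point $x_0$ is attractive, indifferent, repeller if $|f'(x_0)|_p<1$, $=1$, $>1$ respectively. The basin of attraction is $A(x_0)=\{x: f^n(x)\text{ is defined for all }n\text{ and }f^n(x)\to x_0\}$. A sphere $S$ is invariant if $f$ is defined on $S$ and $f(S)\subset S$. An open ball $U_r(x_0)$ about a fixed point $x_0$ is a Siegel disk if every sphere $S_\rho(x_0)$,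 $0<\rho<r$, is invariant; $SI(x_0)$ is the union of all Siegel disks centred at $x_0$ (the maximal Siegel disk). *)

(* Defs.v *)
From HB Require Import structures.
From mathcomp Require Import all_boot all_order all_algebra.
From mathcomp Require Import boolp classical_sets reals.

Set Implicit Arguments.
Unset Strict Implicit.
Unset Printing Implicit Defensive.

Import Order.TTheory GRing.Theory Num.Theory.

Local Open Scope classical_set_scope.
Local Open Scope ring_scope.

Definition open_ball (R : realType) (K : fieldType) (abs : K -> R)
    (c : K) (r : R) : set K := [set x | abs (x - c) < r].

Definition closed_ball (R : realType) (K : fieldType) (abs : K -> R)
    (c : K) (r : R) : set K := [set x | abs (x - c) <= r].

Definition sphere (R : realType) (K : fieldType) (abs : K -> R)
    (c : K) (r : R) : set K := [set x | abs (x - c) = r].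

Definition converges (R : realType) (K : fieldType) (abs : K -> R)
    (u : nat -> K) (l : K) : Prop :=
  forall e : R, 0 < e ->
    exists N : nat, forall n : nat, (N <= n)%N -> abs (u n - l) < e.

Definition cauchy_sequence (R : realType) (K : fieldType) (abs : K -> R)
    (u : nat -> K) : Prop :=
  forall e : R, 0 < e ->
    exists N : nat, forall m n : nat, (N <= m)%N -> (N <= n)%N ->
      abs (u m - u n) < e.

Definition adherence (R : realType) (K : fieldType) (abs : K -> R)
    (A : set K) : set K :=
  [set x | forall e : R, 0 < e -> exists2 y, A y & abs (y - x) < e].

Definition padic_abs (R : realType) (p : nat) (q : rat) : R :=
  if q == 0 then 0
  else p%:R ^+ logn p `|denq q|%N / p%:R ^+ logn p `|numq q|%N.

(* When [abs] extends the p-adic absolute value and K is complete, the closure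
   of the prime field is the completion of the rationals, i.e. Q_p. *)
Definition Qp (R : realType) (K : fieldType) (abs : K -> R) : set K :=
  adherence abs (range (fun q : rat => ratr q : K)).

Definition algebraic_over (K : fieldType) (F : set K) : set K :=
  [set x | exists P : {poly K}, [/\ P != 0, forall i, F P`_i & root P x]].

(* C_p is the completion of an algebraic closure of Q_p. Algebraic closures and
   completions are determined up to isomorphism only, so C_p is given by its
   defining properties, which fix (K, abs) up to isometric isomorphism. By
   [Cp_split] the elements of K algebraic over Q_p form an algebraic closure of
   Q_p; by [Cp_complete] and [Cp_dense] K is the completion of that closure
   (and hence is algebraically closed itself). *)
Record is_Cp (R : realType) (p : nat) (K : fieldType) (abs : K -> R) : Prop := {
  Cp_abs_ge0 : forall x, 0 <= abs x;
  Cp_abs_eq0 : forall x, abs x = 0 <-> x = 0;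
  Cp_absM : forall x y, abs (x * y) = abs x * abs y;
  Cp_absD : forall x y, abs (x + y) <= Num.max (abs x) (abs y);
  Cp_abs_rat : forall q : rat, abs (ratr q) = padic_abs R p q;
  Cp_complete : forall u : nat -> K,
    cauchy_sequence abs u -> exists l, converges abs u l;
  Cp_split : forall P : {poly K},
    (forall i, Qp abs P`_i) -> (1 < size P)%N -> exists x, root P x;
  Cp_dense : adherence abs (algebraic_over (Qp abs)) = [set: K]
}.

(* A partially defined self-map of K is a function [K -> option K], with value
   [None] outside of its domain; iterates propagate [None]. *)
Definition piter (K : Type) (g : K -> option K) (n : nat) (x : K) : option K :=
  iter n (obind g) (Some x).

Definition defined_in (K : Type) (o : option K) (A : set K) : Prop :=
  exists2 y, o = Some y & A y.

Definition fixed_point (K : Type) (g : K -> option K) (x0 : K) : Prop :=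
  g x0 = Some x0.

Definition has_derivative (R : realType) (K : fieldType) (abs : K -> R)
    (g : K -> option K) (x0 l : K) : Prop :=
  exists2 y0, g x0 = Some y0 &
    forall e : R, 0 < e -> exists2 delta : R, 0 < delta &
      forall h : K, 0 < abs h < delta ->
        exists2 y, g (x0 + h) = Some y & abs ((y - y0) / h - l) < e.

Definition attractive (R : realType) (K : fieldType) (abs : K -> R)
    (g : K -> option K) (x0 : K) : Prop :=
  fixed_point g x0 /\ exists2 l, has_derivative abs g x0 l & abs l < 1.

Definition basin (R : realType) (K : fieldType) (abs : K -> R)
    (g : K -> option K) (x0 : K) : set K :=
  [set x | exists2 u : nat -> K,
     forall n, piter g n x = Some (u n) & converges abs u x0].

Definition invariant_set (K : Type) (g : K -> option K) (S : set K) : Prop :=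
  forall x, S x -> defined_in (g x) S.

Definition is_siegel_disk (R : realType) (K : fieldType) (abs : K -> R)
    (g : K -> option K) (x0 : K) (U : set K) : Prop :=
  fixed_point g x0 /\
  exists r : R, [/\ 0 < r, U = open_ball abs x0 r &
    forall rho : R, 0 < rho < r -> invariant_set g (sphere abs x0 rho)].

Definition SI (R : realType) (K : fieldType) (abs : K -> R)
    (g : K -> option K) (x0 : K) : set K :=
  \bigcup_(U in is_siegel_disk abs g x0) U.

Definition f (K : fieldType) (a b d : K) (x : K) : option K :=
  if x ^+ 2 + d * x + b == 0 then None
  else Some ((a * x ^+ 2 + b * x) / (x ^+ 2 + d * x + b)).

Definition pole_orbits (K : fieldType) (a b d xh1 xh2 : K) : set K :=
  [set x | exists n : nat, defined_in (piter (f a b d) n x) [set xh1; xh2]].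

(* Main.v *)
Require Import Defs.
From HB Require Import structures.
From mathcomp Require Import all_boot all_order all_algebra.
From mathcomp Require Import boolp classical_sets reals.
From mathcomp Require Import ring lra.

Set Implicit Arguments.
Unset Strict Implicit.
Unset Printing Implicit Defensive.

Import Order.TTheory GRing.Theory Num.Theory.

Local Open Scope classical_set_scope.
Local Open Scope ring_scope.

(* Write u, v for the poles, so that f(x) = x(ax+b)/((x-u)(x-v)) with b = uv,
   and put r = |u||v|/|a|, which is the norm of the zero -b/a of f.  The
   ultrametric inequality gives |f(x)| = |x| for |x| < r and |f(x)| <= r for
   |x| = r, while on r < |x| <= |v| the ratio |f(x)|/|x| is at least
   min(|x|/r, |a|/|v|) > 1.  Hence an orbit that starts outside the closed ball
   of radius r and avoids the poles enters |x| > |v|, and then lies on the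
   sphere |x| = |a|, where f(x) - x2 = (x - x2)(dx+b)/((x-u)(x-v)) shows that
   f contracts towards x2 with ratio |v|/|a|.  The Siegel disk cannot be larger
   because f maps -b/a, which is on the sphere of radius r, to 0. *)

Lemma expr_unbounded (R : archiRealFieldType) (l M : R) :
  1 < l -> exists n, M < l ^+ n.
Proof.
move=> l1.
have Bernoulli n : 1 + (l - 1) * n%:R <= l ^+ n.
  elim: n => [|n IH]; first by rewrite mulr0 addr0 expr0.
  have : (l - 1) * 1 <= (l - 1) * l ^+ n.
    by apply: ler_wpM2l; [lra | exact/exprn_ege1/ltW].
  by rewrite exprS -natr1; lra.
exists (Num.bound `|M / (l - 1)|); apply: lt_le_trans (Bernoulli _).
have l0 : 0 < l - 1 by lra.
have := le_lt_trans (ler_norm _) (archi_boundP (normr_ge0 (M / (l - 1)))).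
by rewrite ltr_pdivrMr//; lra.
Qed.

(** * Ultrametric absolute values *)

Record ultrametric_abs (R : realType) (K : fieldType) (abs : K -> R) : Prop := {
  uabs_ge0 : forall x, 0 <= abs x;
  uabs_eq0 : forall x, abs x = 0 <-> x = 0;
  uabsM : forall x y, abs (x * y) = abs x * abs y;
  uabsD : forall x y, abs (x + y) <= Num.max (abs x) (abs y)
}.

Section UltrametricAbs.
Variables (R : realType) (K : fieldType) (abs : K -> R).
Hypothesis habs : ultrametric_abs abs.

Lemma uabs0 : abs 0 = 0.
Proof. exact/(uabs_eq0 habs). Qed.

Lemma uabs_gt0 x : (0 < abs x) = (x != 0).
Proof.
rewrite lt_neqAle (uabs_ge0 habs) andbT eq_sym; congr (~~ _).
by apply/eqP/eqP => /(uabs_eq0 habs).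
Qed.

Lemma uabs1 : abs 1 = 1.
Proof.
have h : abs 1 != 0 by rewrite gt_eqF// uabs_gt0 oner_neq0.
by apply: (mulfI h); rewrite -(uabsM habs) !mulr1.
Qed.

Lemma uabsN x : abs (- x) = abs x.
Proof.
rewrite -mulN1r (uabsM habs).
suff -> : abs (-1) = 1 by rewrite mul1r.
have := uabs_ge0 habs (-1).
have : abs (-1) * abs (-1) = 1 by rewrite -(uabsM habs) mulrNN mulr1 uabs1.
by nra.
Qed.

Lemma uabsV x : abs x^-1 = (abs x)^-1.
Proof.
have [->|x0] := eqVneq x 0; first by rewrite invr0 uabs0 invr0.
have h : abs x != 0 by rewrite gt_eqF// uabs_gt0.
by apply: (mulfI h); rewrite -(uabsM habs) !divff// uabs1.
Qed.

Lemma uabsB x y : abs (x - y) <= Num.max (abs x) (abs y).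
Proof. by rewrite -(uabsN y) (uabsD habs). Qed.

Lemma uabsD_le x y e : abs x <= e -> abs y <= e -> abs (x + y) <= e.
Proof.
by move=> xe ye; apply: le_trans (uabsD habs x y) _; rewrite ge_max xe.
Qed.

Lemma uabsB_le x y e : abs x <= e -> abs y <= e -> abs (x - y) <= e.
Proof. by move=> xe ye; apply: le_trans (uabsB x y) _; rewrite ge_max xe. Qed.

(** Isosceles principle: y = (x + y) - x gives |y| <= max(|x + y|, |x|), and |x| is too small to be
    the larger bound. *)
Lemma uabsD_ltr x y : abs x < abs y -> abs (x + y) = abs y.
Proof.
move=> xy; apply/eqP; rewrite eq_le uabsD_le ?(ltW xy)//=.
have := uabsB (x + y) x; rewrite addrC addKr le_max => /orP[//|yx].
by move: xy; rewrite ltNge yx.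
Qed.

Lemma uabsD_ltl x y : abs y < abs x -> abs (x + y) = abs x.
Proof. by rewrite addrC; exact: uabsD_ltr. Qed.

Lemma uabsB_ltr x y : abs x < abs y -> abs (x - y) = abs y.
Proof. by move=> xy; rewrite uabsD_ltr uabsN. Qed.

Lemma uabsB_ltl x y : abs y < abs x -> abs (x - y) = abs x.
Proof. by move=> xy; rewrite uabsD_ltl// uabsN. Qed.

Lemma converges_geometric (w : nat -> K) (x : K) (N : nat) (l C : R) :
  0 < l < 1 -> (forall n, abs (w (N + n)%N - x) <= l ^+ n * C) ->
  converges abs w x.
Proof.
move=> /andP[l0 l1] hw e e0.
(* This [n] satisfies C / e < l^(-n), that is l^n C < e. *)
have [n hn] := @expr_unbounded R l^-1 (C / e) ltac:(by rewrite invf_gt1).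
exists (N + n)%N => m hm.
have -> : m = (N + (m - N))%N by rewrite subnKC// (leq_trans _ hm)// leq_addr.
have C0 : 0 <= C.
  by have := hw 0; rewrite expr0 mul1r; exact/le_trans/(uabs_ge0 habs).
apply: le_lt_trans (hw _) _.
apply: (@le_lt_trans _ _ (l ^+ n * C)).
  apply: ler_wpM2r => //; apply: ler_wiXn2l; rewrite ?(ltW l0) ?(ltW l1)//.
  by rewrite leq_subRL// (leq_trans _ hm)// leq_addr.
move: hn; rewrite ltr_pdivrMr// exprVn ltr_pdivlMl ?exprn_gt0//.
Qed.

End UltrametricAbs.

(** * Norm estimates for f in terms of its poles *)

Section Dynamics.
Variables (R : realType) (K : fieldType) (abs : K -> R).
Hypothesis habs : ultrametric_abs abs.
Variables a b d u v : K.
Hypotheses (bE : b = u * v) (dE : d = - (u + v)).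
Hypotheses (u_neq0 : u != 0) (lt_uv : abs u < abs v) (lt_va : abs v < abs a).

Let r := abs u * abs v / abs a.
Let x2 := a - d.
Let g := f a b d.

Local Lemma u_gt0 : 0 < abs u.
Proof. by rewrite (uabs_gt0 habs). Qed.

Local Lemma v_gt0 : 0 < abs v.
Proof. exact: lt_trans u_gt0 lt_uv. Qed.

Local Lemma a_gt0 : 0 < abs a.
Proof. exact: lt_trans v_gt0 lt_va. Qed.

Local Lemma abs_b : abs b = r * abs a.
Proof. by rewrite /r divfK ?gt_eqF ?a_gt0// bE (uabsM habs). Qed.

Local Lemma abs_bE : r * abs a = abs u * abs v.
Proof. by rewrite -abs_b bE (uabsM habs). Qed.

Local Lemma r_gt0 : 0 < r.
Proof. by rewrite divr_gt0 ?mulr_gt0 ?u_gt0 ?v_gt0 ?a_gt0. Qed.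

Local Lemma r_lt_u : r < abs u.
Proof. by rewrite ltr_pdivrMr ?a_gt0// ltr_pM2l ?u_gt0. Qed.

Local Lemma abs_d : abs d = abs v.
Proof. by rewrite dE (uabsN habs) (uabsD_ltr habs). Qed.

Local Lemma abs_x2 : abs x2 = abs a.
Proof. by rewrite (uabsB_ltl habs)// abs_d. Qed.

Local Lemma denominatorE x : x ^+ 2 + d * x + b = (x - u) * (x - v).
Proof. by rewrite bE dE; ring. Qed.

Lemma f_pole x : x = u \/ x = v -> g x = None.
Proof.
by case=> ->; rewrite /g /f denominatorE subrr ?mul0r ?mulr0 eqxx.
Qed.

Lemma f_defined x : x != u -> x != v -> exists y, g x = Some y.
Proof.
move=> xu xv; rewrite /g /f denominatorE mulf_eq0 !subr_eq0.
by rewrite (negPf xu) (negPf xv)/=; eexists.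
Qed.

Lemma f_someE x y : g x = Some y ->
  [/\ 0 < abs (x - u), 0 < abs (x - v)
    & y = x * (a * x + b) / ((x - u) * (x - v))].
Proof.
rewrite /g /f denominatorE; case: ifPn => //.
rewrite mulf_eq0 negb_or !(uabs_gt0 habs) => /andP[-> ->] [<-].
by split=> //; congr (_ / _); ring.
Qed.

(** Cleared of denominators, so that in each region it remains to insert the norms of x - u, x - v
    and ax + b and cancel. *)
Lemma abs_f x y : g x = Some y ->
  abs y * (abs (x - u) * abs (x - v)) = abs x * abs (a * x + b).
Proof.
case/f_someE => xu xv ->.
rewrite !(uabsM habs) (uabsV habs) (uabsM habs) divfK//.
by rewrite mulf_neq0 ?gt_eqF.
Qed.

(** Here x is dominated in every factor: the denominator has norm |u||v|, and ax + b has the same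
    norm |b|. *)
Lemma f_Siegel x : abs x < r -> exists2 y, g x = Some y & abs y = abs x.
Proof.
move=> xr; have xu := lt_trans xr r_lt_u; have xv := lt_trans xu lt_uv.
have [||y gy] := @f_defined x.
- by apply: contraTneq xu => ->; rewrite ltxx.
- by apply: contraTneq xv => ->; rewrite ltxx.
exists y => //; have := abs_f gy.
rewrite !(uabsB_ltr habs)// (uabsD_ltr habs) => [|].
  rewrite abs_b -abs_bE; apply: mulIf.
  by rewrite mulf_neq0 ?gt_eqF ?r_gt0 ?a_gt0.
by rewrite (uabsM habs) abs_b mulrC ltr_pM2r ?a_gt0.
Qed.

(** On the boundary |ax| = |b|, so ax + b may cancel and only |ax + b| <= |b| survives; the
    denominator still has norm |u||v|. *)
Lemma f_closed_ball x : abs x <= r -> exists2 y, g x = Some y & abs y <= r.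
Proof.
move=> xr; have xu := le_lt_trans xr r_lt_u; have xv := lt_trans xu lt_uv.
have [||y gy] := @f_defined x.
- by apply: contraTneq xu => ->; rewrite ltxx.
- by apply: contraTneq xv => ->; rewrite ltxx.
exists y => //; have := abs_f gy.
rewrite !(uabsB_ltr habs)// -abs_bE => yE.
have ra0 : 0 < r * abs a by rewrite mulr_gt0 ?r_gt0 ?a_gt0.
rewrite -(ler_pM2r ra0) yE ler_pM ?(uabs_ge0 habs)// (uabsD_le habs)//.
  by rewrite (uabsM habs) mulrC ler_pM2r ?a_gt0.
by rewrite abs_b.
Qed.

Lemma abs_numerator x : r < abs x -> abs (a * x + b) = abs a * abs x.
Proof.
move=> rx; rewrite (uabsD_ltl habs) (uabsM habs)// abs_b mulrC.
by rewrite ltr_pM2l ?a_gt0.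
Qed.

(** The rate [l] is left free: 1 shows that the exterior is preserved, and a rate above 1 forces
    escape. *)
Lemma f_expands x y l : 0 <= l -> l * r <= abs x -> l * abs v <= abs a ->
  r < abs x <= abs v -> g x = Some y -> l * abs x <= abs y.
Proof.
move=> l0 lr lv /andP[rx xv] gy; have := abs_f gy; rewrite abs_numerator//.
have [xu0 xv0 _] := f_someE gy => yE.
have x0 : 0 < abs x by exact: lt_trans r_gt0 rx.
have PQ : 0 < abs (x - u) * abs (x - v) by rewrite mulr_gt0.
rewrite -(ler_pM2r PQ) yE mulrAC mulrC ler_pM2l//.
have le_xv : abs (x - v) <= abs v by rewrite (uabsB_le habs).
apply: (@le_trans _ _ (l * (abs (x - u) * abs v))).
  by rewrite ler_wpM2l// ler_wpM2l// ltW.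
(* If |x - u| <= |x|, the bound l |v| <= |a| suffices; if |x - u| <= |u|, then |u||v| = r |a| and l
   r <= |x| do. *)
have := uabsB habs x u; rewrite le_max => /orP[Px|Pu].
  apply: (@le_trans _ _ (l * (abs x * abs v))).
    by rewrite ler_wpM2l// ler_wpM2r// ltW// v_gt0.
  by rewrite mulrCA mulrC ler_wpM2r// ltW.
apply: (@le_trans _ _ (l * (abs u * abs v))).
  by rewrite ler_wpM2l// ler_wpM2r// ltW// v_gt0.
by rewrite -abs_bE mulrA mulrC ler_pM2l ?a_gt0.
Qed.

Lemma f_outer_defined x : abs v < abs x -> exists y, g x = Some y.
Proof.
move=> vx; apply: f_defined.
  by apply: contraTneq vx => ->; rewrite -leNgt ltW.
by apply: contraTneq vx => ->; rewrite ltxx.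
Qed.

Lemma f_outer x y : abs v < abs x -> g x = Some y -> abs y = abs a.
Proof.
move=> vx gy; have ux := lt_trans lt_uv vx; have rx := lt_trans r_lt_u ux.
have x0 : 0 < abs x by exact: lt_trans r_gt0 rx.
have := abs_f gy; rewrite abs_numerator// !(uabsB_ltl habs)//.
rewrite [RHS]mulrCA; apply: mulIf.
by rewrite mulf_neq0 ?gt_eqF.
Qed.

(** One identity with three uses: it shows that [x2] is fixed, it gives the contraction ratio, and
    its cofactor at [x2] is the derivative there. *)
Lemma f_sub_x2 x y : g x = Some y ->
  y - x2 = (x - x2) * ((d * x + b) / ((x - u) * (x - v))).
Proof.
move=> gy; have [xu xv ->] := f_someE gy.
move: xu xv; rewrite !(uabs_gt0 habs) => xu xv.
rewrite /x2 bE dE; field; exact/andP.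
Qed.

Local Lemma abs_dxb x : abs v <= abs x -> abs (d * x + b) <= abs v * abs x.
Proof.
move=> vx; rewrite (uabsD_le habs) ?(uabsM habs) ?abs_d// bE (uabsM habs) mulrC.
by rewrite ler_pM2l ?v_gt0// (le_trans _ vx)// ltW.
Qed.

Lemma f_contracts x y : abs x = abs a -> g x = Some y ->
  abs (y - x2) <= abs v / abs a * abs (x - x2).
Proof.
move=> xa gy; rewrite (f_sub_x2 gy) (uabsM habs) mulrC.
apply: ler_wpM2r; first exact: (uabs_ge0 habs).
have ltua := lt_trans lt_uv lt_va.
rewrite (uabsM habs) (uabsV habs) (uabsM habs) !(uabsB_ltl habs) ?xa//.
rewrite ler_pdivrMr ?mulr_gt0 ?a_gt0// mulrA divfK ?gt_eqF ?a_gt0//.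
by rewrite -xa abs_dxb// xa ltW.
Qed.

Lemma f_x2 : fixed_point g x2.
Proof.
have [|y gy] := @f_outer_defined x2; first by rewrite abs_x2.
rewrite /fixed_point gy; congr Some; apply/eqP.
by rewrite -subr_eq0 (f_sub_x2 gy) subrr mul0r.
Qed.

Lemma attractive_x2 : attractive abs g x2.
Proof.
have [x2u0 x2v0 _] := f_someE f_x2.
have ltua := lt_trans lt_uv lt_va.
have B x : abs x = abs a -> abs (x - u) = abs a /\ abs (x - v) = abs a.
  by move=> xa; rewrite !(uabsB_ltl habs) xa.
have [B2u B2v] := B _ abs_x2.
split; first exact: f_x2.
exists ((d * x2 + b) / ((x2 - u) * (x2 - v))); last first.
  rewrite (uabsM habs) (uabsV habs) (uabsM habs) B2u B2v.
  rewrite ltr_pdivrMr ?mulr_gt0 ?a_gt0// mul1r.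
  apply: le_lt_trans (abs_dxb _) _; rewrite abs_x2 ?ltW//.
  by rewrite ltr_pM2r// a_gt0.
exists x2; first exact: f_x2.
(* The bound |h| < |a| keeps x2 + h on the sphere of radius |a|; there the error of the difference
   quotient is at most |h| / |a|, whence e |a|. *)
move=> e e0; exists (Num.min (abs a) (e * abs a)).
  by rewrite lt_min a_gt0 mulr_gt0// a_gt0.
move=> h; rewrite lt_min => /and3P[h0 ha he].
have xa : abs (x2 + h) = abs a by rewrite (uabsD_ltl habs) abs_x2.
have [Bu Bv] := B _ xa.
have [|y gy] := @f_outer_defined (x2 + h); first by rewrite xa.
exists y => //; rewrite (f_sub_x2 gy) [x2 + h - x2]addrC addKr.
rewrite mulrAC divff -?(uabs_gt0 habs)// mul1r.
(* The increment of the cofactor is divisible by h; the factor x2 + h + a is 2 x2 + d + h, since x2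
   + d = a. *)
have -> : (d * (x2 + h) + b) / ((x2 + h - u) * (x2 + h - v))
    - (d * x2 + b) / ((x2 - u) * (x2 - v))
  = h * (d * ((x2 - u) * (x2 - v)) - (d * x2 + b) * (x2 + h + a))
    / ((x2 + h - u) * (x2 + h - v) * ((x2 - u) * (x2 - v))).
  have: x2 + h - u != 0 by rewrite -(uabs_gt0 habs) Bu a_gt0.
  have: x2 + h - v != 0 by rewrite -(uabs_gt0 habs) Bv a_gt0.
  move: x2u0 x2v0; rewrite !(uabs_gt0 habs) /x2 bE dE => *.
  by field; do ?[apply/andP; split].
have a0 := a_gt0.
rewrite (uabsM habs) (uabsV habs) !(uabsM habs) Bu Bv B2u B2v.
rewrite ltr_pdivrMr ?mulr_gt0//.
apply: (@le_lt_trans _ _ (abs h * (abs a * (abs a * abs a)))).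
  apply: ler_wpM2l; first exact: (uabs_ge0 habs).
  apply: (uabsB_le habs).
    rewrite !(uabsM habs) B2u B2v abs_d.
    by rewrite ler_pM2r ?mulr_gt0// ltW.
  rewrite (uabsM habs) mulrA; apply: ler_pM; rewrite ?(uabs_ge0 habs)//.
    apply: le_trans (abs_dxb _) _; rewrite abs_x2 ?ltW//.
    by rewrite ltr_pM2r.
  by rewrite (uabsD_le habs)// xa.
have -> : e * (abs a * abs a * (abs a * abs a)) =
  e * abs a * (abs a * (abs a * abs a)) by ring.
by rewrite ltr_pM2r// !mulr_gt0.
Qed.

(** * The Siegel disk at 0 and its boundary sphere *)

Lemma SI_0 : SI abs g 0 = open_ball abs 0 r.
Proof.
have b0 : b != 0.
  by rewrite -(uabs_gt0 habs) abs_b mulr_gt0 ?r_gt0 ?a_gt0.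
have fix0 : fixed_point g 0.
  by rewrite /fixed_point /g /f expr0n !mulr0 !add0r (negPf b0) mul0r.
apply/seteqP; split=> [x [U [_ [s [s0 -> inv]]]]|x xr]; last first.
  exists (open_ball abs 0 r) => //; split=> //; exists r; split=> //.
    exact: r_gt0.
  move=> rho /andP[rho0 rhor] z; rewrite /sphere/= subr0 => zrho.
  have [|y gy yz] := @f_Siegel z; first by rewrite zrho.
  by exists y; rewrite //= subr0 yz.
rewrite /open_ball/= => xs; apply: (lt_le_trans xs).
rewrite leNgt; apply/negP => rs.
have a0 : a != 0 by rewrite -(uabs_gt0 habs) a_gt0.
(* A disk of radius [s > r] would make the sphere of radius [r] invariant, but this sphere contains
   a zero of f. *)
have zr : abs (- b / a) = r.
  by rewrite (uabsM habs) (uabsN habs) (uabsV habs) abs_b mulfK// gt_eqF ?a_gt0.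
have [||y gy] := inv r _ (- b / a); rewrite ?r_gt0 ?rs//=.
  by rewrite /sphere/= subr0.
rewrite /sphere/= subr0 => yr; have := abs_f gy.
rewrite [a * _]mulrC divfK// addNr (uabs0 habs) mulr0 yr => /eqP.
have [zu0 zv0 _] := f_someE gy.
by rewrite gt_eqF// mulr_gt0 ?r_gt0 ?mulr_gt0.
Qed.

Lemma piter_Siegel x n : abs x < r ->
  exists2 y, piter g n x = Some y & abs y = abs x.
Proof.
move=> xr; elim: n => [|n [y gy yx]]; first by exists x.
have [|z gz zy] := @f_Siegel y; first by rewrite yx.
by exists z; rewrite ?zy// /piter iterS -/(piter g n x) gy.
Qed.

Lemma piter_closed_ball x n : abs x <= r ->
  exists2 y, piter g n x = Some y & abs y <= r.
Proof.
move=> xr; elim: n => [|n [y gy yx]]; first by exists x.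
have [z gz zy] := f_closed_ball yx.
by exists z; rewrite // /piter iterS -/(piter g n x) gy.
Qed.

Lemma piterD (h : K -> option K) m n x y :
  piter h n x = Some y -> piter h (m + n) x = piter h m y.
Proof. by rewrite /piter iterD => ->. Qed.

(** The orbit cannot leave the closed ball, so it can quit the sphere only inwards, and in the open
    ball the norm is constant from then on. *)
Lemma orbit_of_boundary x : sphere abs 0 r x ->
  (exists (k : nat) (mu : R),
     [/\ (1 <= k)%N, 0 <= mu < r,
         forall m : nat, (k <= m)%N ->
           defined_in (piter g m x) (sphere abs 0 mu) &
         forall m : nat, (m <= k - 1)%N ->
           defined_in (piter g m x) (sphere abs 0 r)])
  \/ (forall k : nat, (1 <= k)%N -> defined_in (piter g k x) (sphere abs 0 r)).
Proof.
rewrite {1}/sphere/= subr0 => xr.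
have [H|] := pselect (forall k, defined_in (piter g k x) (sphere abs 0 r)).
  by right.
move/existsNP => exk; left.
have {exk} : exists k, `[< ~ defined_in (piter g k x) (sphere abs 0 r) >].
  by case: exk => k /asboolP ?; exists k.
(* [k] is the first exit time, positive because x itself lies on the sphere; [mu] will be the norm
   of the k-th iterate, possibly 0. *)
case/ex_minnP => k /asboolP leaves kmin.
have k0 : (0 < k)%N.
  rewrite lt0n; apply/eqP => k0; apply: leaves; rewrite k0.
  by exists x; rewrite /sphere//= subr0.
have [|y gy yr] := @piter_closed_ball x k; first by rewrite xr.
have {}yr : abs y < r.
  rewrite lt_neqAle yr andbT; apply/eqP => yE.
  by apply: leaves; exists y; rewrite // /sphere/= subr0.
exists k, (abs y); split=> //; first by rewrite (uabs_ge0 habs).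
  move=> m km; rewrite -(subnK km) (piterD _ gy).
  have [z gz zy] := @piter_Siegel y (m - k) yr.
  by exists z; rewrite // /sphere/= subr0.
(* An earlier exit would contradict minimality; as [k] is positive, [m <= k - 1] does mean m < k. *)
move=> m mk; apply: contrapT => /asboolP/kmin.
by rewrite leqNgt => /negP; apply; rewrite -(subnK k0) addn1 ltnS.
Qed.

(** * Orbits outside the closed ball and the basin of x2 *)

Lemma f_preserves_exterior x y : r < abs x -> g x = Some y -> r < abs y.
Proof.
move=> rx gy; have [xv|vx] := leP (abs x) (abs v).
  apply: (lt_le_trans rx); rewrite -[leLHS]mul1r.
  apply: (f_expands _ _ _ _ gy) => //.
  - by rewrite mul1r ltW.
  - by rewrite mul1r ltW.
  - by rewrite rx.
by rewrite (f_outer vx gy) (lt_trans r_lt_u)// (lt_trans lt_uv).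
Qed.

Lemma orbit_escapes (w : nat -> K) : (forall n, g (w n) = Some (w n.+1)) ->
  r < abs (w 0%N) -> exists n, abs v < abs (w n).
Proof.
move=> gw w0.
have r0 := r_gt0; have v0 := v_gt0; have w00 := lt_trans r0 w0.
(* The largest rate that [f_expands] allows at the starting point for every |x| <= |v|. It stays
   valid along the orbit, whose norms do not fall below the initial one while they are at most
   |v|. *)
pose l := Num.min (abs (w 0%N) / r) (abs a / abs v).
have l1 : 1 < l.
  by rewrite lt_min (ltr_pdivlMr _ _ r0) (ltr_pdivlMr _ _ v0) !mul1r w0.
have l0 : 0 < l by exact: lt_trans l1.
apply: contrapT => /forallNP H.
have {}H n : abs (w n) <= abs v by rewrite leNgt; apply/negP.
have grows n : [/\ r < abs (w n), abs (w 0%N) <= abs (w n)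
               & l ^+ n * abs (w 0%N) <= abs (w n)].
  elim: n => [|n [rn wn IH]]; first by rewrite expr0 mul1r.
  have lw : l * abs (w n) <= abs (w n.+1).
    apply: (f_expands _ _ _ _ (gw n)); rewrite ?rn ?H ?(ltW l0)//.
      by apply: le_trans wn; rewrite -ler_pdivlMr// ge_min lexx.
    by rewrite -ler_pdivlMr// ge_min lexx orbT.
  split.
  - exact: f_preserves_exterior rn (gw n).
  - apply: (le_trans wn); apply: le_trans lw.
    by rewrite ler_peMl ?(uabs_ge0 habs)// ltW.
  - by apply: le_trans lw; rewrite exprS -mulrA ler_pM2l.
have [n] := @expr_unbounded R l (abs v / abs (w 0%N)) l1.
rewrite ltr_pdivrMr// => vn.
have [_ _ wn] := grows n.
by have := H n; rewrite leNgt (lt_le_trans vn).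
Qed.

Lemma orbit_converges (w : nat -> K) : (forall n, g (w n) = Some (w n.+1)) ->
  r < abs (w 0%N) -> converges abs w x2.
Proof.
move=> gw w0; have [N vN] := orbit_escapes gw w0.
(* The iterate at time [N] is only known to have norm above |v|; the sphere of radius |a| is reached
   one step later. *)
have wa n : abs (w (N.+1 + n)%N) = abs a.
  elim: n => [|n IH]; first by rewrite addn0 (f_outer vN (gw N)).
  by rewrite addnS; apply: (f_outer _ (gw _)); rewrite IH.
apply: (@converges_geometric _ _ _ habs _ _ N.+1 (abs v / abs a)
  (abs (w N.+1 - x2))).
  by rewrite divr_gt0 ?v_gt0 ?a_gt0//= ltr_pdivrMr ?a_gt0// mul1r.
elim=> [|n IH]; first by rewrite addn0 expr0 mul1r.
rewrite addnS; apply: le_trans (f_contracts (wa n) (gw _)) _.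
by rewrite exprS -[leRHS]mulrA ler_pM2l// divr_gt0 ?v_gt0 ?a_gt0.
Qed.

Lemma basin_x2 : basin abs g x2 =
  [set: K] `\` (closed_ball abs 0 r `|` pole_orbits a b d u v).
Proof.
apply/seteqP; split=> x.
  case=> w gw cw; split=> // -[|[n [y gy uvy]]].
    rewrite /closed_ball/= subr0 => xr.
    (* Tolerance |a| is enough: every point of the closed ball is at distance exactly |a| from
       [x2]. *)
    have [N /(_ N (leqnn N))] := cw _ a_gt0.
    have [y gy yr] := @piter_closed_ball x N xr.
    have wy : w N = y by apply: Some_inj; rewrite -gw -gy.
    have ya : abs y < abs x2.
      by rewrite abs_x2 (le_lt_trans yr)// (lt_trans r_lt_u)// (lt_trans lt_uv).
    by rewrite wy (uabsB_ltr habs)// abs_x2 ltxx.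
  (* An iterate at a pole makes the next one [None], whereas an orbit in the basin is defined
     forever. *)
  have := gw n.+1; rewrite /piter iterS -/(piter g n x) [piter _ _ _]gy/=.
  by rewrite (f_pole uvy).
case=> _ /not_orP[]; rewrite /closed_ball/= subr0 => /negP; rewrite -ltNge.
move=> rx nopole.
have total n : exists y, piter g n x = Some y.
  elim: n => [|n [y gy]]; first by exists x.
  rewrite /piter iterS -/(piter g n x) gy /=; apply: f_defined.
    by apply/eqP => yu; apply: nopole; exists n; exists y => //; left.
  by apply/eqP => yv; apply: nopole; exists n; exists y => //; right.
have [w gw] := choice total; exists w => //.
apply: orbit_converges => [n|].
  by rewrite -gw /piter iterS -/(piter g n x) gw.
by have [<-] := gw 0%N.
Qed.

End Dynamics.

(** * Passage to C_p *)

Lemma is_Cp_ultrametric (R : realType) (p : nat) (K : fieldType)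
  (abs : K -> R) : is_Cp p abs -> ultrametric_abs abs.
Proof. by case. Qed.

Lemma Vieta_quadratic (K : fieldType) (b d u v : K) :
  'X^2 + d *: 'X + b%:P = ('X - u%:P) * ('X - v%:P) ->
  b = u * v /\ d = - (u + v).
Proof.
move=> E.
have h x : x ^+ 2 + d * x + b = (x - u) * (x - v).
  by move/(congr1 (horner^~ x)): E; rewrite !hornerE.
(* Evaluation at 0 gives b; evaluation at 1 below then gives d. *)
have bE : b = u * v by have := h 0; rewrite expr0n mulr0 !add0r mulrNN.
split=> //; apply: (addrI 1); apply: (addIr b).
by have := h 1; rewrite expr1n mulr1 => ->; rewrite bE; ring.
Qed.

Theorem theorem9 (R : realType) (p : nat) (p_prime : prime p)
    (Cp : fieldType) (abs : Cp -> R) (hCp : is_Cp p abs)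
    (a b d xh1 xh2 : Cp) (alpha beta : R)
    (hab : a * b != 0) (had : a != d)
    (hroots : 'X^2 + d *: 'X + b%:P = ('X - xh1%:P) * ('X - xh2%:P))
    (halpha : alpha = abs xh1) (hbeta : beta = abs xh2)
    (hx2 : b + a * (a - d) != 0)
    (hlt : alpha < beta < abs a) :
  let r := alpha * beta / abs a in
  let x1 : Cp := 0 in
  let x2 : Cp := a - d in
  [/\ SI abs (f a b d) x1 = open_ball abs 0 r /\ sphere abs 0 (abs a) x2,
      forall x : Cp, sphere abs 0 r x ->
        (exists (k : nat) (mu : R),
           [/\ (1 <= k)%N, 0 <= mu < r,
               forall m : nat, (k <= m)%N ->
                 defined_in (piter (f a b d) m x) (sphere abs 0 mu) &
               forall m : nat, (m <= k - 1)%N ->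
                 defined_in (piter (f a b d) m x) (sphere abs 0 r)])
        \/ (forall k : nat, (1 <= k)%N ->
              defined_in (piter (f a b d) k x) (sphere abs 0 r))
    & attractive abs (f a b d) x2 /\
      basin abs (f a b d) x2 =
        [set: Cp] `\` (closed_ball abs 0 r `|` pole_orbits a b d xh1 xh2)].
Proof.
have habs := is_Cp_ultrametric hCp.
have [bE dE] := Vieta_quadratic hroots.
move: hlt; rewrite {}halpha {}hbeta => /andP[lt12 lt2a] r x1 x2.
(* The ordering alone would permit alpha = 0; it is excluded because b is the product of the
   poles. *)
have u0 : xh1 != 0.
  by apply: contraNneq hab => u0; rewrite bE u0 mul0r mulr0.
split; first split.
- exact: SI_0.
- by rewrite /sphere/= subr0; exact: (abs_x2 habs dE).
- exact: orbit_of_boundary.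
- split; [exact: (attractive_x2 habs bE dE) | exact: basin_x2].
Qed.
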